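(* Let $N\ge3$ and let $(G,S)$ be a Cayley graph satisfying $\beta_S(n)\ge C(S)n^N$ for all $n\ge1$, for some constant $C(S)>0$. Then there are direct sum decompositions $$\ell^2(E)=\nabla D_0^{1,2}(G)\oplus H\qquad\text{and}\qquad\ell^2(E)=\nabla D^{1,2}(G)\oplus H,$$ where $H:=\{u\in\ell^2(E):\operatorname{div}u=0\}$.
   Context: $G$ is a finitely generated group and $S$ a finite generating set with $S=S^{-1}$. The Cayley graph $(G,S)$ has vertex set $V=G$, and $x\sim y$ iff $x=ys$ for some $s\in S$; $E$ is its edge set, with a fixed orientation, so each $e\in E$ has an initial endpoint $e_-$ and a terminal endpoint $e_+$, and $e=(e_-,e_+)$. $\beta_S(n)$ is the number of elements of $G$ at word distance at most $n$ from the unit element. For $u:G\to\mathbb R$, $\nabla u:E\to\mathbb R$ is $\nabla_eu:=u(e_+)-u(e_-)$. For $\alpha:E\to\mathbb R$ and $x\in V$, $\operatorname{div}\alpha(x):=\sum_{e=(y,x)\in E}\alpha(e)-\sum_{\tilde e=(x,y)\in E}\alpha(\tilde e)$. $\lVert u\rVert_{D^{1,2}(G)}:=\left(\sum_{x\in G}\sum_{y\sim x}|u(y)-u(x)|^2\right)^{1/2}$. $D_0^{1,2}(G)$ is the completion of the finitely supported functions in this norm, its elements being regarded as functions on $G$ (a Cauchy sequence of finitely supported functions is identified with its pointwise limit), and $D^{1,2}(G):=\{u\in\ell^{\frac{2N}{N-2}}(G):\lVert u\rVert_{D^{1,2}(G)}<\infty\}$. $\nabla D_0^{1,2}(G)$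 and $\nabla D^{1,2}(G)$ denote the images of these spaces under $\nabla$. *)

(* Defs.v *)
From HB Require Import structures.
From mathcomp Require Import all_boot all_order all_algebra finmap.
From mathcomp Require Import all_classical all_reals all_analysis.

Set Implicit Arguments.
Unset Strict Implicit.
Unset Printing Implicit Defensive.

Import Order.TTheory GRing.Theory Num.Theory.
Import numFieldNormedType.Exports.

Local Open Scope classical_set_scope.
Local Open Scope ring_scope.

Section CayleyGraph.
Context {G : groupType}.
Implicit Types (S : {fset G}) (E : set (G * G)).

Definition symmetric_fset S := forall s, (s^-1%g \in S) = (s \in S).

Definition word_of S (w : seq G) (g : G) :=
  {subset w <= S} /\ (\prod_(s <- w) s)%g = g.

Definition generating S := forall g : G, exists w, word_of S w g.

Definition adj S (x y : G) := exists2 s, s \in S & x = (y * s)%g.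

Definition word_ball S (n : nat) : set G :=
  [set g | exists2 w, (size w <= n)%N & word_of S w g].

(* [word_ball S n] is finite, so [fset_set] does not take its default value. *)
Definition growth S (n : nat) : nat := #|` fset_set (word_ball S n)|.

(* The pair [(x, y)] is the edge with initial endpoint [x] and terminal
   endpoint [y]; every undirected edge is kept in exactly one direction.
   If [1 \in S], each vertex carries one loop [(x, x)]. *)
Definition orientation S E :=
  [/\ forall x y, E (x, y) -> adj S x y,
      forall x y, adj S x y -> E (x, y) \/ E (y, x) &
      forall x y, E (x, y) -> E (y, x) -> x = y].

End CayleyGraph.

Section FunctionSpaces.
Context {R : realType}.

(* Unordered sums of nonnegative terms are taken in the extended reals. *)
Definition ell {T : choiceType} (p : R) : set (T -> R) :=
  [set f | (\esum_(x in [set: T]) (`|f x| `^ p)%:E < +oo)%E].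

Context {G : groupType}.
Implicit Types (S : {fset G}) (E : set (G * G)) (u : G -> R).

Definition grad E u : E -> R := fun e => u (val e).2 - u (val e).1.

(* When [E] orients the Cayley graph of a finite [S], both sums are finite. *)
Definition div E (a : E -> R) : G -> R := fun x =>
  \sum_(e \in [set e : E | (val e).2 = x]) a e -
  \sum_(e \in [set e : E | (val e).1 = x]) a e.

Definition D12_norm S u : \bar R :=
  ((\esum_(x in [set: G]) \esum_(y in [set y | adj S y x])
      (`|u y - u x| ^+ 2)%:E) `^ 2^-1)%E.

Definition finitely_supported u := finite_set [set x | u x != 0].

(* The completion, realised as the pointwise limits of the Cauchy sequences. *)
Definition D012 S : set (G -> R) :=
  [set u | exists v : nat -> G -> R,
    [/\ forall n, finitely_supported (v n),
        forall eps : R, 0 < eps -> exists n0 : nat, forall m n : nat,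
          (n0 <= m)%N -> (n0 <= n)%N ->
          (D12_norm S (v m - v n)%R < eps%:E)%E &
        forall x, v n x @[n --> \oo] --> u x]].

Definition D12 S (N : R) : set (G -> R) :=
  [set u | ell (2 * N / (N - 2)) u /\ (D12_norm S u < +oo)%E].

Definition divergence_free E : set (E -> R) :=
  [set a | ell 2 a /\ forall x, div a x = 0].

End FunctionSpaces.

Arguments grad {R G} E u.
Arguments divergence_free {R G} E _.

(* [W] is the internal direct sum of its linear subspaces [A] and [B]. *)
Definition direct_sum {R : realType} {V : lmodType R} (W A B : set V) :=
  [/\ submod_closed [in A], submod_closed [in B],
      W = [set a + b | a in A & b in B] & A `&` B = [set 0]].

(* Main.v *)
Require Import Defs.
From HB Require Import structures.
From mathcomp Require Import all_boot all_order all_algebra finmap.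
From mathcomp Require Import all_classical all_reals all_analysis.
From mathcomp Require Import ring lra zify.

(** Finite-energy fields on the edges split orthogonally because the closure
    of the gradients of finitely supported functions has the divergence-free
    fields as its orthogonal complement: pairing a field [a] with the gradient
    of the indicator of a vertex [x] gives [div a x] ([div_pairing]).
    Given [a] in l^2(E), a minimizing sequence [v_n] for the distance from
    [a] to these gradients is Cauchy in energy by the parallelogram identity,
    and the pairings of [a - grad v_n] with the gradients of indicators tend
    to 0 ([minimizing_sequence]).  What must be shown is that the limit in
    l^2(E) is again the gradient of a function, that this function lies in both
    spaces, and that the sums are direct.

    All of this rests on the Sobolev inequality
    sum |f|^p <= K * energy(f)^(p/2), p = 2N/(N-2), for finitely supported [f]
    ([sobolev]).  It makes an energy-Cauchy sequence of finitely supported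
    functions converge at every vertex, so the minimizing sequence has a limit
    [u] in D_0^{1,2} with [a - grad u] divergence free
    ([D012_decomposition]); passing to the limit in the inequality puts
    D_0^{1,2} inside D^{1,2} ([D012_ell_energy]), which gives the sum also for
    the larger space.  The sums are direct since a harmonic function in l^p
    vanishes: its positive values have a maximum, the maximum spreads to all of
    the connected graph, and [G] is infinite by the growth hypothesis
    ([harmonic_eq0]).

    The Sobolev inequality comes from the volume growth in two moves.  First, a
    capacity estimate ([capacity_ball]): if [u] is at least [l] on [A] and
    vanishes off [Z], and the ball of radius [n] has at least twice as many
    elements as [Z], then right translation by half of the ball moves each point
    of [A] out of [Z]; since translation by an element of length at most [n]
    changes [u] by at most n^2 * energy(u) in square norm, l^2 |A| is at most
    2 n^2 energy(u).  Choosing [n] of order |Z|^(1/N) gives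
    l^2 |A| <= K |Z|^(2/N) energy(u) ([faber_krahn]).  Secondly, this is applied
    to each dyadic layer of [f].  With t_k = m 2^k and
    b_k = t_k^p |{f >= t_k}| the exponents match so that
    b_(k+1) <= K' b_k^(2/N) energy(k-th layer); as the energies of the layers
    add up to at most the energy of [f], the sum B of the b_k, which is
    comparable to the sum of f^p, satisfies B <= K'' B^(2/N) energy(f). *)

Set Implicit Arguments.
Unset Strict Implicit.
Unset Printing Implicit Defensive.

Import Order.TTheory GRing.Theory Num.Theory.
Import numFieldNormedType.Exports.

Local Open Scope classical_set_scope.
Local Open Scope ring_scope.

(** * Unordered sums of nonnegative reals *)

Section UnorderedSums.
Context {R : realType} {T : choiceType}.
Implicit Types (D : set T) (a : T -> R).

Lemma fsum_le_esum D (A : {fset T}) a : (forall x, 0 <= a x) ->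
  [set` A] `<=` D -> ((\sum_(x <- A) a x)%:E <= \esum_(x in D) (a x)%:E)%E.
Proof.
move=> a0 AD; apply: esum_ge; exists [set` A]; first by split.
by rewrite fsbig_finite// set_fsetK sumEFin.
Qed.

Lemma esum_le_fsum D (a : T -> R) (M : \bar R) :
  (forall A : {fset T}, [set` A] `<=` D -> ((\sum_(x <- A) a x)%:E <= M)%E) ->
  (\esum_(x in D) (a x)%:E <= M)%E.
Proof.
move=> H; apply: ge_ereal_sup => /= _ [X [finX XD] <-].
rewrite fsbig_finite// sumEFin; apply: H => x /=.
by rewrite in_fset_set// inE => /XD.
Qed.

Lemma esumZ D (c : R) a : 0 <= c -> (forall x, 0 <= a x) ->
  (\esum_(x in D) (c * a x)%:E = c%:E * \esum_(x in D) (a x)%:E)%E.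
Proof.
have le (d : R) (b : T -> R) : 0 <= d -> (forall x, 0 <= b x) ->
    (\esum_(x in D) (d * b x)%:E <= d%:E * \esum_(x in D) (b x)%:E)%E.
  move=> d0 b0; apply: esum_le_fsum => A AD.
  by rewrite -mulr_sumr EFinM lee_wpmul2l ?lee_fin// fsum_le_esum.
move=> c0 a0; apply/eqP; rewrite eq_le le//=.
have [->|cN0] := eqVneq c 0; first by rewrite mul0e esum_ge0// => x _; rewrite mul0r.
have cp : 0 < c by rewrite lt_neqAle eq_sym cN0.
rewrite -lee_pdivlMl// (le_trans _ (le c^-1 _ _ _))//; last 2 first.
- by rewrite invr_ge0.
- by move=> x; rewrite mulr_ge0.
by apply: le_esum => x _; rewrite mulKf.
Qed.

Lemma le_esum_set D D' a : (forall x, 0 <= a x) -> D `<=` D' ->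
  (\esum_(x in D) (a x)%:E <= \esum_(x in D') (a x)%:E)%E.
Proof.
move=> a0 DD'; apply: esum_le_fsum => A AD; apply: fsum_le_esum => //.
exact: subset_trans AD DD'.
Qed.

Lemma esum_setU_le D D1 D2 a : (forall x, 0 <= a x) -> D `<=` D1 `|` D2 ->
  (\esum_(x in D) (a x)%:E <=
    \esum_(x in D1) (a x)%:E + \esum_(x in D2) (a x)%:E)%E.
Proof.
move=> a0 DU; rewrite (esumID D1) => [|x _]; last by rewrite lee_fin.
apply: leeD; apply: le_esum_set => // x [] // Dx nD1.
by have [] := DU _ Dx.
Qed.

Lemma esum_lty_finite_support D (A : set T) a : (forall x, 0 <= a x) ->
  finite_set A -> (forall x, D x -> ~ A x -> a x = 0) ->
  (\esum_(x in D) (a x)%:E < +oo)%E.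
Proof.
move=> a0 finA aA; rewrite (esumID A) => [|x _]; last by rewrite lee_fin.
rewrite [X in (_ + X)%E]esum1 ?adde0 => [|x [Dx nAx]]; last by rewrite aA.
apply: (@le_lt_trans _ _ (\esum_(x in A) (a x)%:E)%E).
  by apply: le_esum_set => // x [].
rewrite esum_fset// => [|x _]; last by rewrite lee_fin.
by rewrite fsbig_finite// sumEFin ltry.
Qed.

(** Fatou's lemma in the form used below: comparing with [b n] eventually,
    rather than taking limits, allows [a] to be a fixed fraction of a pointwise
    limit. *)
Lemma esum_eventually_le D (b : nat -> T -> R) a (M : \bar R) :
  (forall n x, 0 <= b n x) ->
  (forall n, \esum_(x in D) (b n x)%:E <= M)%E ->
  (forall x, \forall n \near \oo, a x <= b n x) ->
  (\esum_(x in D) (a x)%:E <= M)%E.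
Proof.
move=> b0 bM ab; apply: esum_le_fsum => A AD.
have [n0 _ /(_ n0 (leqnn _)) H] :
    nbhs \oo (\bigcap_(x in [set` A]) [set n | a x <= b n x]).
  by apply: filter_bigI => x _; exact: ab.
apply: le_trans (bM n0); apply: le_trans (fsum_le_esum (b0 n0) AD).
by rewrite lee_fin big_seq [leRHS]big_seq; apply: ler_sum => x /H.
Qed.

End UnorderedSums.

Section SquareSums.
Context {R : realType} {T : choiceType}.
Implicit Types (D : set T) (f g : T -> R).

Definition sqsum D f : \bar R := \esum_(x in D) (f x ^+ 2)%:E.

Lemma sqsum_ge0 D f : (0 <= sqsum D f)%E.
Proof. by apply: esum_ge0 => x _; rewrite lee_fin sqr_ge0. Qed.

Lemma eq_sqsum D f g : (forall x, f x ^+ 2 = g x ^+ 2) -> sqsum D f = sqsum D g.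
Proof. by move=> fg; apply: eq_esum => x _; rewrite fg. Qed.

Lemma le_sqsum D f g : (forall x, f x ^+ 2 <= g x ^+ 2) ->
  (sqsum D f <= sqsum D g)%E.
Proof. by move=> fg; apply: le_esum => x _; rewrite lee_fin. Qed.

Lemma sqsumZ D (c : R) f :
  sqsum D (fun x => c * f x) = ((c ^+ 2)%:E * sqsum D f)%E.
Proof.
rewrite -esumZ ?sqr_ge0// => [|x]; last exact: sqr_ge0.
by apply: eq_esum => x _; rewrite exprMn.
Qed.

Lemma sqsum_parallelogram D f g :
  (sqsum D (fun x => (f x + g x)%R) + sqsum D (fun x => (f x - g x)%R) =
   2%:E * (sqsum D f + sqsum D g))%E.
Proof.
have sq0 (h : T -> R) x : D x -> (0 <= (h x ^+ 2)%:E)%E.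
  by rewrite lee_fin sqr_ge0.
rewrite /sqsum -!esumD => [|x _|x _|x _|x _]; rewrite ?lee_fin ?sqr_ge0//.
under [in RHS]eq_esum do rewrite -EFinD.
rewrite -esumZ// => [|x]; last by rewrite addr_ge0 ?sqr_ge0.
by apply: eq_esum => x _; rewrite -EFinD; congr EFin; ring.
Qed.

Lemma sqsumD_le D f g :
  (sqsum D (fun x => f x + g x)%R <= 2%:E * (sqsum D f + sqsum D g))%E.
Proof. by rewrite -sqsum_parallelogram leeDl// sqsum_ge0. Qed.

Lemma sqsum_lin_lty D (c : R) f g : (sqsum D f < +oo)%E -> (sqsum D g < +oo)%E ->
  (sqsum D (fun x => c * f x + g x)%R < +oo)%E.
Proof.
move=> ff gf; apply: le_lt_trans (sqsumD_le _ _ _) _.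
rewrite lte_mul_pinfty ?lee_fin// lte_add_pinfty// sqsumZ.
by rewrite lte_mul_pinfty// lee_fin sqr_ge0.
Qed.

Lemma ell2E f : ell 2 f <-> (sqsum [set: T] f < +oo)%E.
Proof.
rewrite /ell/= /sqsum; under eq_esum do rewrite powR_mulrn// real_normK ?num_real//.
by [].
Qed.

End SquareSums.

(** * Energy and translations *)

Section Energy.
Context {R : realType} {G : groupType}.
Implicit Types (S : {fset G}) (u : G -> R).

(** Ordered adjacent pairs, so that each undirected edge is counted twice in
    [energy], as in [D12_norm]. *)
Definition arcs S : set (G * G) := [set k | adj S k.2 k.1].

Definition diff_along u : G * G -> R := fun k => u k.2 - u k.1.

Definition energy S u : \bar R := sqsum (arcs S) (diff_along u).

Lemma energy_ge0 S u : (0 <= energy S u)%E.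
Proof. exact: sqsum_ge0. Qed.

Lemma D12_normE S u : D12_norm S u = (energy S u `^ 2^-1)%E.
Proof.
rewrite /D12_norm esum_esum => [|x y _ _]; last by rewrite lee_fin sqr_ge0.
congr (_ `^ _)%E; rewrite /energy /sqsum.
rewrite (_ : [set: G] `*`` _ = arcs S); last first.
  by apply/seteqP; split=> [[x y] []|[x y]].
by apply: eq_esum => k _; rewrite real_normK ?num_real.
Qed.

(** The sum runs over the arcs [(x, x * s)] only, for a single generator. *)
Lemma energy_shift S u s : s \in S ->
  (sqsum [set: G] (fun x => (u (x * s)%g - u x)%R) <= energy S u)%E.
Proof.
move=> sS; pose e (x : G) := (x, (x * s)%g).
rewrite /sqsum -(@esum_image _ _ _ [set: G] e (fun k => (diff_along u k ^+ 2)%:E)).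
  apply: le_esum_set => [k|_ [x _ <-]]; first exact: sqr_ge0.
  by exists s.
by move=> x y _ _ [].
Qed.

(** The weights are chosen so that, with [a] of square size k^2 and [b] of
    square size 1, the right-hand side is (k + 1)^2. *)
Lemma sqr_add_weighted (k : nat) (a b : R) : (0 < k)%N ->
  (a + b) ^+ 2 <= (1 + k%:R^-1) * a ^+ 2 + (1 + k%:R) * b ^+ 2.
Proof.
move=> k0; have kp : 0 < k%:R :> R by rewrite ltr0n.
rewrite -subr_ge0 (_ : _ - _ = k%:R^-1 * (a - k%:R * b) ^+ 2).
  by rewrite mulr_ge0 ?invr_ge0 ?sqr_ge0// ltW.
by field; rewrite gt_eqF.
Qed.

(** Pseudo-Poincare inequality: a word of length [k] is a path of [k] edges,
    and the weights of [sqr_add_weighted] give the factor k^2 by induction. *)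
Lemma energy_word S u (w : seq G) : {subset w <= S} ->
  (sqsum [set: G] (fun x => (u (x * \prod_(s <- w) s)%g - u x)%R) <=
   ((size w)%:R ^+ 2)%:E * energy S u)%E.
Proof.
elim: w => [|s w IHw] wS.
  rewrite big_nil /sqsum esum1 => [|x _]; last by rewrite mulg1 subrr expr0n.
  by rewrite expr0n mul0e.
have sS : s \in S by apply: wS; rewrite mem_head.
have {}wS : {subset w <= S} by move=> x xw; apply: wS; rewrite inE xw orbT.
(* The weights below need a nonempty tail. *)
have [w0|wN0] := posnP (size w).
  rewrite (size0nil w0) big_seq1 expr1n mul1e; exact: energy_shift.
rewrite big_cons; set h := (\prod_(t <- w) t)%g in IHw *.
pose a x := u (x * s * h)%g - u (x * s)%g; pose b x := u (x * s)%g - u x.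
set k : R := (size w)%:R; have kp : 0 < k by rewrite ltr0n.
have ale : (sqsum [set: G] a <= (k ^+ 2)%:E * energy S u)%E.
  apply: le_trans (IHw wS).
  rewrite /sqsum [leRHS](reindex_esum [set: G] [set: G] (fun x => (x * s)%g))//.
  split=> [//|x y _ _ /mulIg//|y _]; exists (y * s^-1)%g => //.
  by rewrite mulgVK.
have ble : (sqsum [set: G] b <= energy S u)%E by exact: energy_shift.
have k1 : 0 <= 1 + k^-1 by rewrite addr_ge0// invr_ge0 ltW.
have k2 : 0 <= 1 + k by rewrite addr_ge0// ltW.
apply: (@le_trans _ _ ((1 + k^-1)%:E * sqsum [set: G] a +
    (1 + k)%:E * sqsum [set: G] b)%E).
  rewrite /sqsum -(esumZ _ k1 (fun x => sqr_ge0 (a x))).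
  rewrite -(esumZ _ k2 (fun x => sqr_ge0 (b x))).
  rewrite -esumD => [|x _|x _]; last 2 first.
  - by rewrite lee_fin; apply: mulr_ge0 => //; exact: sqr_ge0.
  - by rewrite lee_fin; apply: mulr_ge0 => //; exact: sqr_ge0.
  apply: le_esum => x _; rewrite lee_fin mulgA.
  rewrite (_ : u _ - u x = a x + b x); last by rewrite /a /b; ring.
  exact: sqr_add_weighted.
apply: (@le_trans _ _ ((1 + k^-1)%:E * ((k ^+ 2)%:E * energy S u) +
    (1 + k)%:E * energy S u)%E).
  by apply: leeD; apply: lee_wpmul2l; rewrite ?lee_fin.
rewrite muleA -EFinM -ge0_muleDl; last 2 first.
- by rewrite lee_fin; apply: mulr_ge0 => //; exact: sqr_ge0.
- by rewrite lee_fin.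
rewrite -EFinD (_ : (1 + k^-1) * k ^+ 2 + (1 + k) = (size (s :: w))%:R ^+ 2)//.
by rewrite -[size (s :: w)]/(size w).+1 -natr1 -/k; field; rewrite gt_eqF.
Qed.

(** For an infinite [A] the finite set [fset_set A] is empty by convention. *)
Lemma mem_fset_set (T : choiceType) (A : set T) x : x \in fset_set A -> A x.
Proof.
have [finA|infA] := pselect (finite_set A).
  by rewrite in_fset_set// inE.
by rewrite /fset_set; case: pselect => // _; rewrite inE.
Qed.

Lemma energy_ball S u n g : g \in fset_set (word_ball S n) ->
  (sqsum [set: G] (fun x => (u (x * g)%g - u x)%R) <=
   (n%:R ^+ 2)%:E * energy S u)%E.
Proof.
move=> /mem_fset_set[w wn [wS <-]].
apply: le_trans (energy_word u wS) _.
apply: lee_wpmul2r; first exact: energy_ge0.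
by rewrite lee_fin lerXn2r ?nnegrE// ler_nat.
Qed.

Lemma leq_card_translate (B Z : {fset G}) (x : G) :
  (count (fun g => (x * g)%g \in Z) B <= #|` Z|)%N.
Proof.
rewrite -size_filter -(size_map (fun g => (x * g)%g)) cardfE -?cardfE.
apply: uniq_leq_size => [|_ /mapP[g + ->]]; last by rewrite mem_filter => /andP[].
by rewrite map_inj_uniq ?filter_uniq ?fset_uniq// => a b /mulgI.
Qed.

(** Double counting of (u(xg) - u(x))^2 over [x] in [A] and [g] in the ball of
    radius [n]. For fixed [g] the sum is bounded by [energy_ball]; for fixed
    [x] at most |Z| of the points [x g] lie in [Z], so at least half of the
    terms are at least l^2. *)
Lemma capacity_ball S u (A Z : {fset G}) (l : R) n : (0 < n)%N -> 0 < l ->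
  (forall x, x \in A -> l <= u x) -> (forall x, x \notin Z -> u x = 0) ->
  (2 * #|` Z| <= growth S n)%N ->
  ((l ^+ 2 * #|` A|%:R)%:E <= (2 * n%:R ^+ 2)%:E * energy S u)%E.
Proof.
have half_le (b z c1 c2 : nat) : (c1 + c2 = b -> c1 <= z -> 2 * z <= b ->
    b <= 2 * c2)%N by lia.
move=> n0 l0 lA uZ Zn; have n2 : 0 < n%:R ^+ 2 :> R by rewrite exprn_gt0 ?ltr0n.
have := energy_ge0 S u; have := @energy_ball S u n.
case: (energy S u) => [e eB e0| |//]; last first.
  by move=> _ _; rewrite gt0_muley ?leey// lte_fin mulr_gt0.
rewrite lee_fin in e0.
move: Zn; rewrite /growth; set B := fset_set _ in eB *.
have [->|[a aA]] := fset_0Vmem A.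
  by rewrite cardfs0 mulr0 -EFinM lee_fin !mulr_ge0// ltW.
move=> Zn.
have B0 : (0 < #|` B|)%N.
  have aZ : a \in Z.
    by apply: contraT => /uZ ua; have := lA _ aA; rewrite ua leNgt l0.
  have : (0 < #|` Z|)%N by rewrite cardfs_gt0; apply/fset0Pn; exists a.
  by move=> Z0; apply: leq_trans Zn; rewrite muln_gt0.
have up g : g \in B -> \sum_(x <- A) (u (x * g)%g - u x) ^+ 2 <= n%:R ^+ 2 * e.
  move=> gB; rewrite -lee_fin EFinM; apply: le_trans (eB g gB).
  by apply: fsum_le_esum => // x; exact: sqr_ge0.
have low x : x \in A ->
    l ^+ 2 * (#|` B|%:R / 2) <= \sum_(g <- B) (u (x * g)%g - u x) ^+ 2.
  move=> xA; apply: (@le_trans _ _ (\sum_(g <- B | (x * g)%g \notin Z) l ^+ 2)).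
    rewrite big_const_seq iter_addr_0 -(mulr_natr (l ^+ 2)) ler_wpM2l ?sqr_ge0//.
    have := leq_card_translate B Z x.
    have := count_predC (fun g => (x * g)%g \in Z) B.
    rewrite -[size B]/(#|` B|).
    set c2 := count _ B; set c1 := count _ B => cB c1Z.
    have : (#|` B| <= 2 * c2)%N := half_le _ _ _ _ cB c1Z Zn.
    by rewrite -(ler_nat R) natrM ler_pdivrMr// mulrC.
  rewrite big_mkcond/=; apply: ler_sum => g _; case: ifPn => [/uZ ->|_].
    have lux := lA x xA; have ux0 : 0 <= u x := le_trans (ltW l0) lux.
    by rewrite sub0r sqrrN; apply: lerXn2r => //; rewrite nnegrE// ltW.
  exact: sqr_ge0.
rewrite -EFinM lee_fin.
have : \sum_(x <- A) l ^+ 2 * (#|` B|%:R / 2) <= \sum_(g <- B) (n%:R ^+ 2 * e).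
  apply: (@le_trans _ _ (\sum_(x <- A) \sum_(g <- B) (u (x * g)%g - u x) ^+ 2)).
    by rewrite big_seq [leRHS]big_seq; apply: ler_sum.
  by rewrite exchange_big/= big_seq [leRHS]big_seq; apply: ler_sum.
rewrite !big_const_seq !count_predT !iter_addr_0.
rewrite -(mulr_natr (_ * _) (size A)) -(mulr_natr (_ * e) (size B)).
rewrite -[size A]/(#|` A|) -[size B]/(#|` B|).
have Bp : 0 < #|` B|%:R :> R by rewrite ltr0n.
rewrite (_ : _ * _ * #|` A|%:R = l ^+ 2 * #|` A|%:R * (#|` B|%:R / 2)); last by ring.
rewrite (_ : _ * _ * #|` B|%:R = 2 * n%:R ^+ 2 * e * (#|` B|%:R / 2)); last by field.
by rewrite ler_pM2r// divr_gt0.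
Qed.

End Energy.

(** * The Faber-Krahn inequality *)

Section FaberKrahn.
Context {R : realType} {G : groupType} (S : {fset G}) (N C : R).
Hypothesis N_gt0 : 0 < N.
Hypothesis C_gt0 : 0 < C.
Hypothesis growth_lb :
  forall n : nat, (1 <= n)%N -> C * n%:R `^ N <= (growth S n)%:R.

(** The least integer above (2z/C)^(1/N); the additive 1 from rounding is
    absorbed since z >= 1. *)
Lemma growth_radius (z : nat) : (0 < z)%N -> exists n : nat,
  [/\ (0 < n)%N, (2 * z <= growth S n)%N &
      n%:R <= ((2 / C) `^ N^-1 + 1) * z%:R `^ N^-1].
Proof.
move=> z0; pose y := (2 / C * z%:R) `^ N^-1.
have y0 : 0 <= y by exact: powR_ge0.
have zp : 0 < z%:R :> R by rewrite ltr0n.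
have cz : 0 <= 2 / C * z%:R by rewrite mulr_ge0 ?divr_ge0 ?ltW.
have Ni : N^-1 != 0 by rewrite invr_eq0 gt_eqF.
exists (Num.truncn y).+1; split => //.
  rewrite -(ler_nat R) (le_trans _ (growth_lb _))//.
  apply: (@le_trans _ _ (C * y `^ N)); last first.
    rewrite ler_pM2l//; apply: ge0_ler_powR; rewrite ?nnegrE ?(ltW N_gt0)//.
    exact/ltW/truncnS_gt.
  rewrite /y -powRrM mulVf ?gt_eqF// powRr1//.
  by rewrite natrM mulrA mulrCA divff ?gt_eqF// mulr1.
rewrite -natr1 mulrDl mul1r lerD//.
  rewrite -powRM ?divr_ge0 ?(ltW C_gt0)//.
  by have /andP[] := truncn_itv y0.
by rewrite -[leLHS](powRr0 z%:R) ler_powR ?invr_ge0 ?(ltW N_gt0)// ler1n.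
Qed.

(** [capacity_ball] with the radius of [growth_radius], whose square is of
    order |Z|^(2/N). *)
Lemma faber_krahn : exists2 K : R, 0 < K &
  forall (u : G -> R) (A Z : {fset G}) (l : R), 0 < l ->
  (forall x, x \in A -> l <= u x) -> (forall x, x \notin Z -> u x = 0) ->
  ((l ^+ 2 * #|` A|%:R)%:E <= (K * #|` Z|%:R `^ (2 / N))%:E * energy S u)%E.
Proof.
pose k := (2 / C) `^ N^-1 + 1; have k0 : 0 < k by rewrite ltr_wpDl ?powR_ge0.
exists (2 * k ^+ 2) => [|u A Z l l0 lA uZ]; first by rewrite mulr_gt0 ?exprn_gt0.
have [Z0|] := posnP #|` Z|.
  have -> : A = fset0.
    apply/eqP; rewrite -[_ == _]negbK; apply/negP => /fset0Pn[a aA].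
    have := lA a aA; rewrite uZ ?leNgt ?l0//.
    by move/cardfs0_eq : Z0 => ->; rewrite inE.
  rewrite cardfs0 mulr0; apply: mule_ge0; last exact: energy_ge0.
  by rewrite lee_fin mulr_ge0 ?powR_ge0// mulr_ge0 ?exprn_ge0 ?ltW.
move=> /growth_radius[n [n0 Zn nle]].
apply: le_trans (capacity_ball n0 l0 lA uZ Zn) _.
apply: lee_wpmul2r; first exact: energy_ge0.
rewrite lee_fin -mulrA ler_pM2l//.
apply: (@le_trans _ _ ((k * #|` Z|%:R `^ N^-1) ^+ 2)).
  by apply: lerXn2r => //; rewrite nnegrE// mulr_ge0 ?powR_ge0// ltW.
rewrite exprMn (mulrC 2) powRrM powR_mulrn ?powR_ge0//.
Qed.

End FaberKrahn.

(** * Horizontal layers of a function *)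

Section Layers.
Context {R : realType}.
Implicit Types (a b s t : R).

(** The part of the value [a] between the heights [s] and [t]. Written as a
    difference so that consecutive layers telescope. *)
Definition layer s t a := Num.min a t - Num.min a s.

Lemma layer_eq0 s t a : s <= t -> a <= s -> layer s t a = 0.
Proof.
by move=> st as_; rewrite /layer !min_l ?subrr// (le_trans as_).
Qed.

Lemma layer_top s t a : s <= t -> t <= a -> layer s t a = t - s.
Proof. by move=> st ta; rewrite /layer !min_r// (le_trans st). Qed.

Lemma layer_homo s t a b : s <= t -> a <= b -> layer s t a <= layer s t b.
Proof.
move=> st ab; rewrite /layer.
by case: (leP a t); case: (leP a s); case: (leP b t); case: (leP b s); lra.
Qed.

Lemma sum_sqr_le (I : Type) (r : seq I) (d : I -> R) : (forall i, 0 <= d i) ->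
  \sum_(i <- r) d i ^+ 2 <= (\sum_(i <- r) d i) ^+ 2.
Proof.
move=> d0; elim: r => [|i r IHr]; first by rewrite !big_nil expr0n.
rewrite !big_cons sqrrD -addrA lerD2l (le_trans IHr)// lerDr.
by rewrite mulrn_wge0// mulr_ge0// sumr_ge0.
Qed.

(** The layers are monotone functions of the value, so their increments all
    have the sign of a - b; they add up to at most |a - b|, and a sum of
    squares of nonnegative numbers is at most the square of the sum. *)
Lemma sum_layer_sqr_le (t : nat -> R) (L : nat) a b :
  {homo t : m n / (m <= n)%N >-> m <= n} ->
  \sum_(k < L) (layer (t k) (t k.+1) a - layer (t k) (t k.+1) b) ^+ 2
    <= (a - b) ^+ 2.
Proof.
move=> tmono; wlog ba : a b / b <= a.
  move=> H; have [/H//|/ltW/H] := leP b a.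
  by rewrite -(sqrrN (b - a)) opprB; under eq_bigr do rewrite -sqrrN opprB.
have tk k : t k <= t k.+1 by exact: tmono.
apply: le_trans (sum_sqr_le _ _) _ => [k|].
  by rewrite subr_ge0 layer_homo.
have tel c : \sum_(k < L) layer (t k) (t k.+1) c = layer (t 0%N) (t L) c.
  rewrite -(big_mkord xpredT (fun k => layer (t k) (t k.+1) c)).
  exact: (telescope_sumr (fun k => Num.min c (t k))).
have t0L : t 0%N <= t L by exact: tmono.
rewrite sumrB !tel; apply: lerXn2r; rewrite ?nnegrE ?subr_ge0//.
  exact: layer_homo.
rewrite /layer; move: t0L ba; set s := t 0%N; set r := t L => sr ba.
by case: (leP a r); case: (leP a s); case: (leP b r); case: (leP b s); lra.
Qed.

End Layers.

(** * The Sobolev inequality *)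

Section Sobolev.
Context {R : realType} {G : groupType} (S : {fset G}) (N K : R).
Hypothesis N_gt2 : 2 < N.
Hypothesis K_gt0 : 0 < K.
Hypothesis faber_krahn_ineq :
  forall (u : G -> R) (A Z : {fset G}) (l : R), 0 < l ->
  (forall x, x \in A -> l <= u x) -> (forall x, x \notin Z -> u x = 0) ->
  ((l ^+ 2 * #|` A|%:R)%:E <= (K * #|` Z|%:R `^ (2 / N))%:E * energy S u)%E.

Let p : R := 2 * N / (N - 2).

Let N_gt0 : 0 < N. Proof. by rewrite (lt_trans _ N_gt2). Qed.
Let N2_gt0 : 0 < N - 2. Proof. by rewrite subr_gt0. Qed.
Let p_gt2 : 2 < p.
Proof. by rewrite /p ltr_pdivlMr// mulrBr ltrBlDr ltrDl. Qed.
Let p_gt0 : 0 < p. Proof. by rewrite (lt_trans _ p_gt2). Qed.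
Let p_exp : p * (2 / N) = p - 2.
Proof. by rewrite /p; field; rewrite !gt_eqF. Qed.

Section Dyadic.
Variables (f : G -> R) (X : {fset G}) (m q : R) (L : nat).
Hypothesis f_off : forall x, x \notin X -> f x = 0.
Hypothesis m_gt0 : 0 < m.
Hypothesis f_low : forall x, x \in X -> 2 * m <= f x.

Let t (k : nat) : R := m * 2 ^+ k.

Let t_gt0 k : 0 < t k. Proof. by rewrite /t mulr_gt0// exprn_gt0. Qed.
Let tS k : t k.+1 = 2 * t k. Proof. by rewrite /t exprS mulrCA. Qed.
Let t_mono : {homo t : i j / (i <= j)%N >-> i <= j}.
Proof. by move=> i j ij; rewrite /t ler_pM2l// ler_weXn2l// ler1n. Qed.

Hypothesis f_up : forall x, x \in X -> f x < t L.+1.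
Hypothesis energy_f : (energy S f <= q%:E)%E.

Let A (k : nat) : {fset G} := [fset x in X | t k <= f x]%fset.
Let b k : R := t k `^ p * #|` A k|%:R.
Let fk k : G -> R := fun x => layer (t k) (t k.+1) (f x).
Let e k : R := fine (energy S (fk k)).

Let b_ge0 k : 0 <= b k. Proof. by rewrite /b mulr_ge0// powR_ge0. Qed.

Lemma sum_energy_layer_le :
  (\sum_(k < L.+1) energy S (fk k) <= energy S f)%E.
Proof.
rewrite /energy /sqsum -esum_sum => [|i j _ _]; last by rewrite lee_fin sqr_ge0.
apply: le_esum => x _; rewrite sumEFin lee_fin.
exact: (sum_layer_sqr_le L.+1 (f x.2) (f x.1) t_mono).
Qed.

Lemma energy_layerE k : (k < L.+1)%N -> energy S (fk k) = (e k)%:E.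
Proof.
move=> kL; rewrite /e fineK// ge0_fin_numE ?energy_ge0//.
apply: le_lt_trans (ltry q); apply: le_trans energy_f.
apply: le_trans sum_energy_layer_le.
rewrite (bigD1 (Ordinal kL))//= leeDl// sume_ge0// => i _.
exact: energy_ge0.
Qed.

Lemma sum_layer_energy_le : \sum_(k < L.+1) e k <= q.
Proof.
rewrite -lee_fin -sumEFin; apply: le_trans energy_f.
apply: le_trans sum_energy_layer_le.
by apply: lee_sum => k _; rewrite energy_layerE.
Qed.

Lemma layer_energy_ge0 k : 0 <= e k.
Proof. by rewrite fine_ge0// energy_ge0. Qed.

(** [faber_krahn] for the layer between t_k and t_(k+1) = 2 t_k, which is
    supported in {f >= t_k} and equals t_k on {f >= t_(k+1)}. The powers of t_k
    match because 2p/N = p - 2. *)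
Lemma level_step k : (k < L.+1)%N ->
  b k.+1 <= 2 `^ p * K * b k `^ (2 / N) * e k.
Proof.
move=> kL.
have tkS : t k <= t k.+1 by exact: t_mono.
have := @faber_krahn_ineq (fk k) (A k.+1) (A k) (t k) (t_gt0 k) _ _.
rewrite energy_layerE// -EFinM lee_fin => FK.
have {}FK : t k ^+ 2 * #|` A k.+1|%:R <= K * #|` A k|%:R `^ (2 / N) * e k.
  apply: FK => x; rewrite !inE/=.
    by move=> /andP[_ tx]; rewrite /fk layer_top// tS; lra.
  rewrite /fk negb_and => /orP[/f_off ->|]; first by rewrite layer_eq0// ltW.
  by rewrite -ltNge => /ltW fx; rewrite layer_eq0.
have tp : t k `^ p = t k `^ (p - 2) * t k ^+ 2.
  rewrite -(powR_mulrn _ (ltW (t_gt0 k))) -powRD ?subrK//.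
  by rewrite gt_eqF// gt_eqF.
have -> : b k `^ (2 / N) = t k `^ (p - 2) * #|` A k|%:R `^ (2 / N).
  by rewrite /b powRM ?powR_ge0// -powRrM p_exp.
rewrite /b tS powRM ?(ltW (t_gt0 k))// tp.
rewrite (_ : _ * _ * e k = 2 `^ p * t k `^ (p - 2) *
  (K * #|` A k|%:R `^ (2 / N) * e k)); last by ring.
rewrite (_ : _ * #|` A k.+1|%:R = 2 `^ p * t k `^ (p - 2) *
  (t k ^+ 2 * #|` A k.+1|%:R)); last by ring.
by rewrite ler_wpM2l// mulr_ge0 ?powR_ge0.
Qed.

Let B := \sum_(k < L.+1) b k.

(** Since 2m is a lower bound of [f] on its support, {f >= t_0} = {f >= t_1},
    and the term b_0, which [level_step] does not reach, is at most b_1. *)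
Lemma level_shift : B <= 2 * \sum_(k < L.+1) b k.+1.
Proof.
have b01 : b 0%N <= b 1%N.
  have -> : b 0%N = t 0 `^ p * #|` A 1|%:R.
    congr (_ * #|` _ |%:R); apply/fsetP => x; rewrite !inE /t expr0 expr1 mulr1.
    have [xX|//] := boolP (x \in X).
    have := f_low xX => fx; rewrite mulrC fx/=; apply/idP.
    by move: fx m_gt0; lra.
  rewrite /b ler_wpM2r//; apply: ge0_ler_powR; rewrite ?nnegrE ?(ltW (t_gt0 _))//.
    exact: ltW.
  exact: t_mono.
rewrite /B big_ord_recl/= mulr2n mulrDl mul1r; apply: lerD.
  rewrite big_ord_recl/= (le_trans b01)// lerDl sumr_ge0//.
by rewrite big_ord_recr/= lerDl.
Qed.

(** Summing [level_step] with b_k <= B gives B <= c q B^(2/N), and 1 - 2/N =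
    2/p. *)
Lemma level_bound : B <= (2 * (2 `^ p * K) * q) `^ (p / 2).
Proof.
have B0 : 0 <= B by rewrite sumr_ge0.
have q0 : 0 <= q.
  by apply: le_trans sum_layer_energy_le; rewrite sumr_ge0// => k _; exact: layer_energy_ge0.
have K2 : 0 <= 2 `^ p * K by rewrite mulr_ge0 ?powR_ge0// ltW.
have Bq : B <= 2 * (2 `^ p * K) * q * B `^ (2 / N).
  apply: le_trans level_shift _; rewrite -!mulrA ler_pM2l//.
  apply: (@le_trans _ _ (\sum_(k < L.+1) 2 `^ p * K * B `^ (2 / N) * e k)).
    apply: ler_sum => k _; apply: le_trans (level_step (ltn_ord k)) _.
    rewrite ler_wpM2r ?layer_energy_ge0// ler_wpM2l//.
    apply: ge0_ler_powR; rewrite ?nnegrE// ?divr_ge0// ?(ltW N_gt0)//.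
    by rewrite /B (bigD1 k)//= lerDl sumr_ge0.
  rewrite -mulr_sumr !mulrA [leRHS]mulrAC ler_wpM2l ?sum_layer_energy_le//.
  by rewrite mulr_ge0 ?powR_ge0.
have [->|BN0] := eqVneq B 0; first exact: powR_ge0.
have Bp : 0 < B by rewrite lt_neqAle eq_sym BN0.
have Bq' : B `^ (2 / p) <= 2 * (2 `^ p * K) * q.
  rewrite -(ler_pM2r (powR_gt0 (2 / N) Bp)) -powRD; last by rewrite BN0 implybT.
  rewrite (_ : 2 / p + 2 / N = 1) ?powRr1//.
  by rewrite /p; field; rewrite !gt_eqF.
have -> : B = (B `^ (2 / p)) `^ (p / 2).
  by rewrite -powRrM (_ : 2 / p * (p / 2) = 1) ?powRr1//; field; rewrite gt_eqF.
apply: ge0_ler_powR; rewrite ?nnegrE ?powR_ge0//.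
  by rewrite divr_ge0// ltW.
by rewrite !mulr_ge0// ?powR_ge0// ltW.
Qed.

(** Each value of [f] on its support lies in some [t_k, t_(k+1)[ and is charged
    to the level [k]. *)
Lemma sum_powR_level : \sum_(x <- X) f x `^ p <= 2 `^ p * B.
Proof.
apply: (@le_trans _ _ (\sum_(x <- X) \sum_(k < L.+1 | t k <= f x) t k.+1 `^ p)).
  rewrite big_seq [leRHS]big_seq; apply: ler_sum => x xX.
  have f0 : t 0 <= f x.
    by have := f_low xX; rewrite /t expr0 mulr1; move: m_gt0; lra.
  have [k [kL tk kt]] : exists k, [/\ (k < L.+1)%N, t k <= f x & f x < t k.+1].
    have := f_up xX; elim: (L) => [|l IHl]; first by exists 0%N.
    have [/IHl[k [kl ? ?]] _|tl fl] := ltP (f x) (t l.+1).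
      by exists k; split => //; rewrite ltnS ltnW.
    by exists l.+1.
  rewrite (bigD1 (Ordinal kL))//=; apply: (@le_trans _ _ (t k.+1 `^ p)).
    apply: ge0_ler_powR; rewrite ?nnegrE ?(ltW p_gt0) ?(ltW (t_gt0 _)) ?(ltW kt)//.
    exact: le_trans (ltW (t_gt0 k)) tk.
  by rewrite lerDl sumr_ge0// => i _; exact: powR_ge0.
under eq_bigr do rewrite big_mkcond/=.
rewrite exchange_big/= /B mulr_sumr; apply: ler_sum => k _.
rewrite -big_mkcond/= big_const_seq iter_addr_0 -(mulr_natr (_ `^ _)).
rewrite tS powRM ?(ltW (t_gt0 _))// /b mulrA ler_wpM2l ?mulr_ge0 ?powR_ge0//.
rewrite ler_nat -size_filter; apply: uniq_leq_size => [|x].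
  by rewrite filter_uniq// fset_uniq.
by rewrite mem_filter !inE andbC.
Qed.

End Dyadic.

Lemma positive_lower_bound (T : eqType) (s : seq T) (g : T -> R) :
  (forall x, x \in s -> 0 < g x) ->
  exists2 m : R, 0 < m & forall x, x \in s -> m <= g x.
Proof.
elim: s => [_|y s IHs ys]; first by exists 1.
have [x xs|m m0 mg] := IHs; first by apply: ys; rewrite inE xs orbT.
have gy : 0 < g y by apply: ys; rewrite mem_head.
exists (Num.min m (g y)) => [|x]; first by rewrite lt_min m0.
by rewrite inE => /predU1P[->|/mg mx]; rewrite ge_min ?lexx ?orbT ?mx.
Qed.

(** Reduces the Sobolev inequality to nonnegative functions. *)
Lemma energy_norm_le (f : G -> R) :
  (energy S (fun x => `|f x|%R) <= energy S f)%E.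
Proof.
apply: le_sqsum => k; rewrite /diff_along -[leLHS]real_normK ?num_real//.
rewrite -[leRHS]real_normK ?num_real//.
by apply: lerXn2r; rewrite ?nnegrE//; exact: ler_dist_dist.
Qed.

(** The bound is stated for every real [q] above the energy rather than for the
    energy itself, which is an extended real. *)
Lemma sobolev_of_faber_krahn : exists2 K' : R, 0 < K' &
  forall (f : G -> R) (q : R), finitely_supported f ->
  (energy S f <= q%:E)%E ->
  (\esum_(x in [set: G]) (`|f x| `^ p)%:E <= (K' * q `^ (p / 2))%:E)%E.
Proof.
exists (2 `^ p * (2 * (2 `^ p * K)) `^ (p / 2)).
  by rewrite mulr_gt0 ?powR_gt0// mulr_gt0// mulr_gt0// powR_gt0.
move=> f q finf fq; set X := fset_set [set x | f x != 0].
have inX x : (x \in X) = (f x != 0).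
  by rewrite in_fset_set//; apply/idP/idP => [/set_mem|/mem_set].
have [|m m0 mf] := @positive_lower_bound _ X (fun x => `|f x|).
  by move=> x; rewrite inX normr_gt0.
pose M := \sum_(x <- X) `|f x|.
have M0 : 0 <= M by rewrite sumr_ge0.
(* M bounds |f|, and 2^(L+1) exceeds M / (m/2) since 2^j > j; so the last level
   lies above all values. *)
pose L := Num.truncn (M / (m / 2)).
have m2 : 0 < m / 2 by rewrite divr_gt0.
have q0 : 0 <= q by rewrite -lee_fin (le_trans (energy_ge0 S f)).
have f_off x : x \notin X -> `|f x| = 0.
  by rewrite inX negbK => /eqP ->; rewrite normr0.
have f_low x : x \in X -> 2 * (m / 2) <= `|f x|.
  by move=> /mf; rewrite mulrC divfK.
have f_up x : x \in X -> `|f x| < m / 2 * 2 ^+ L.+1.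
  move=> xX; apply: (@le_lt_trans _ _ M).
    by rewrite /M (big_rem x)//= lerDl sumr_ge0.
  rewrite mulrC -ltr_pdivrMr//; apply: lt_trans (truncnS_gt _) _.
  by rewrite -natrX ltr_nat ltn_expl.
have fq' := le_trans (energy_norm_le f) fq.
have := @level_bound (fun x => `|f x|) X (m / 2) q L f_off m2 f_low fq'.
have := @sum_powR_level (fun x => `|f x|) X (m / 2) L m2 f_low f_up.
set B := \sum_(k < _) _ => XB Bq.
apply: (@le_trans _ _ (\sum_(x <- X) `|f x| `^ p)%:E); last first.
  rewrite lee_fin; apply: le_trans XB _.
  rewrite -mulrA ler_pM2l ?powR_gt0// -powRM// ?mulr_ge0 ?powR_ge0//.
  exact: ltW.
apply: esum_le_fsum => A _; rewrite lee_fin.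
rewrite (bigID (fun x => x \in X))/= [X in _ + X]big1 ?addr0 => [|x /f_off ->]; last first.
  by rewrite powR0 ?gt_eqF.
rewrite -big_filter; set r := [seq _ <- _ | _].
have ur : uniq r by rewrite filter_uniq// fset_uniq.
rewrite [leRHS](bigID (fun x => x \in r))/=.
rewrite -[X in _ <= X + _]big_filter.
rewrite (_ : \sum_(x <- r) _ = \sum_(x <- [seq x <- X | x \in r]) `|f x| `^ p).
  by rewrite lerDl sumr_ge0// => x _; exact: powR_ge0.
apply: perm_big; apply: uniq_perm => [//||x]; first by rewrite filter_uniq// fset_uniq.
by rewrite !mem_filter; case: (x \in X); rewrite ?andbF ?andbT.
Qed.

End Sobolev.

Lemma sobolev (R : realType) (G : groupType) (S : {fset G}) (N : R) :
  2 < N ->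
  (exists2 C : R, 0 < C &
    forall n : nat, (1 <= n)%N -> C * n%:R `^ N <= (growth S n)%:R) ->
  exists2 K : R, 0 < K & forall (f : G -> R) (q : R), finitely_supported f ->
  (energy S f <= q%:E)%E ->
  (\esum_(x in [set: G]) (`|f x| `^ (2 * N / (N - 2)))%:E
     <= (K * q `^ (2 * N / (N - 2) / 2))%:E)%E.
Proof.
move=> N2 [C C0 Cgrowth].
have [K K0 FK] := faber_krahn (lt_trans (ltr0Sn R 1) N2) C0 Cgrowth.
exact: sobolev_of_faber_krahn N2 K0 FK.
Qed.

(** * Approximate projection onto a space of square-summable functions *)

Section MinimizingSequence.
Context {R : realType} {T : choiceType}.
Implicit Types (f g a : T -> R).

(** Only the finitely many terms with [x] in [F] change. *)
Lemma sqsum_perturb f g (s : R) (F : {fset T}) :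
  (forall x, x \notin F -> g x = 0) ->
  sqsum [set: T] (fun x => f x - s * g x) =
  (sqsum [set: T] f +
    (s ^+ 2 * \sum_(x <- F) g x ^+ 2 - 2 * s * \sum_(x <- F) f x * g x)%:E)%E.
Proof.
move=> gF.
have split h : sqsum [set: T] h = ((\sum_(x <- F) h x ^+ 2)%:E +
    \esum_(x in ~` [set` F]) (h x ^+ 2)%:E)%E.
  rewrite /sqsum (esumID [set` F]) => [|x _]; last by rewrite lee_fin sqr_ge0.
  rewrite !setTI esum_fset// => [|x _]; last by rewrite lee_fin sqr_ge0.
  by rewrite fsbig_finite// set_fsetK sumEFin.
rewrite !split addeAC -EFinD; congr (_%:E + _)%E.
  rewrite !mulr_sumr -sumrB -big_split/=.
  by apply: eq_bigr => x _; ring.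
by apply: eq_esum => x /= /negP xF; rewrite gF// mulr0 subr0.
Qed.

(** Evaluate at s = c / (1 + g), close to the minimizer c / g but defined also
    when [g] vanishes. *)
Lemma quadratic_bound (c g e : R) : 0 <= g ->
  (forall s : R, 0 <= e + (s ^+ 2 * g - 2 * s * c)) -> c ^+ 2 <= (1 + g) * e.
Proof.
move=> g0 /(_ (c / (1 + g))); have g1 : 0 < 1 + g by rewrite ltr_pwDl.
rewrite (_ : e + _ = ((1 + g) ^+ 2 * e - c ^+ 2 * (g + 2)) / (1 + g) ^+ 2); last first.
  by field; rewrite gt_eqF.
rewrite pmulr_lge0 ?invr_gt0 ?exprn_gt0// subr_ge0 => ce.
have c20 := sqr_ge0 c.
rewrite -(ler_pM2l g1); apply: le_trans (_ : c ^+ 2 * (g + 2) <= _).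
  by rewrite mulrC ler_wpM2l//; lra.
by rewrite mulrA -expr2.
Qed.

(** [w n] is taken within 1/(n+1) of the infimum of the squared distance. The
    midpoint of [w m] and [w n] is no closer than the infimum, so the
    parallelogram identity bounds their distance; and moving from [w n] along
    [g] cannot gain more than 1/(n+1), which by [quadratic_bound] makes the
    residual almost orthogonal to [g]. *)
Lemma minimizing_sequence a (W : set (T -> R)) :
  (sqsum [set: T] a < +oo)%E -> W (fun=> 0) ->
  (forall (c : R) f g, W f -> W g -> W (fun x => c * f x + g x)) ->
  exists w : nat -> T -> R,
  [/\ forall n, W (w n),
      forall m n, (sqsum [set: T] (fun x => (w m x - w n x)%R) <=
        (2 * (m.+1%:R^-1 + n.+1%:R^-1))%:E)%E &
      forall n g (F : {fset T}), W g -> (forall x, x \notin F -> g x = 0) ->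
        (\sum_(x <- F) (a x - w n x) * g x) ^+ 2 <=
          (1 + \sum_(x <- F) g x ^+ 2) * n.+1%:R^-1].
Proof.
move=> afin W0 Wlin.
pose d w : \bar R := sqsum [set: T] (fun x => a x - w x).
pose I := ereal_inf [set d w | w in W].
have I0 : (0 <= I)%E by apply: le_ereal_inf_tmp => _ [w _ <-]; exact: sqsum_ge0.
have Ilt : (I < +oo)%E.
  apply: le_lt_trans afin; apply: ereal_inf_lbound; exists (fun=> 0) => //.
  by apply: eq_sqsum => x; rewrite subr0.
have Ifin : I \is a fin_num by rewrite ge0_fin_numE.
have [i Ii] : exists i, I = i%:E by exists (fine I); rewrite fineK.
have /choice[w wP] n : exists w, W w /\ (d w < i%:E + n.+1%:R^-1%:E)%E.
  have n0 : (0 < n.+1%:R^-1 :> R) by rewrite invr_gt0.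
  by have [_ [w Ww <-] dw] := lb_ereal_inf_adherent n0 Ifin; exists w; rewrite -Ii.
have Id v : W v -> (i%:E <= d v)%E.
  by move=> Wv; rewrite -Ii; apply: ereal_inf_lbound; exists v.
exists w; split=> [n|m n|n g F Wg gF]; first exact: (wP n).1.
- have [Wm dm] := wP m; have [Wn dn] := wP n.
  have Wmid : W (fun x => 2^-1 * w m x + (2^-1 * w n x + 0)).
    by apply: (Wlin) => //; apply: (Wlin).
  have := sqsum_parallelogram [set: T] (fun x => a x - w m x) (fun x => a x - w n x).
  rewrite (_ : sqsum _ (fun x => _ + _) = (4%:E *
    d (fun x => 2^-1 * w m x + (2^-1 * w n x + 0)%R)%R)%E); last first.
    rewrite (_ : 4 = 2 ^+ 2 :> R); last by ring.
    by rewrite /d -sqsumZ; apply: eq_sqsum => x; field.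
  rewrite (_ : sqsum _ (fun x => _ - _) =
    sqsum [set: T] (fun x => w m x - w n x)); last first.
    by apply: eq_sqsum => x; ring.
  move: (Id _ Wmid) dm dn; rewrite -/(d (w m)) -/(d (w n)).
  move: (sqsum_ge0 [set: T] (fun x => w m x - w n x)).
  have := Id _ Wm; have := Id _ Wn.
  case: (d (w n)) => [dn| |]//; case: (d (w m)) => [dm| |]//.
  have e40 : (0 < 4%:E :> \bar R)%E by rewrite lte_fin.
  case: (d _) => [dd| |]//; case: (sqsum _ _) => [r| |]//; last 2 first.
  - by rewrite gt0_muley.
  - by rewrite gt0_muley.
  rewrite -!EFinD -!EFinM -?EFinD !lee_fin !lte_fin => in_ im _ idd dmi dni [].
  set em := _^-1 in dmi *; set en := _^-1 in dni *; lra.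
have [Wn dn] := wP n.
apply: quadratic_bound => [|s]; first by rewrite sumr_ge0// => x _; exact: sqr_ge0.
have Wng : W (fun x => s * g x + (1 * w n x + 0)) by apply: (Wlin) => //; apply: (Wlin).
have := Id _ Wng.
rewrite /d (_ : sqsum _ _ = sqsum [set: T] (fun x => (a x - w n x) - s * g x)); last first.
  by apply: eq_sqsum => x; congr (_ ^+ 2); ring.
rewrite (sqsum_perturb _ _ gF) -/(d (w n)).
move: dn (Id _ Wn); case: (d (w n)) => [dn| |]//.
by rewrite -!EFinD !lee_fin lte_fin; set en := n.+1%:R^-1; lra.
Qed.

End MinimizingSequence.

(** * The completion of the finitely supported functions *)

Section Completion.
Context {R : realType} {G : groupType} (S : {fset G}).
Implicit Types (u v : G -> R) (w : nat -> G -> R).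

Lemma energy_lin_lty (c : R) u v : (energy S u < +oo)%E ->
  (energy S v < +oo)%E -> (energy S (fun x => c * u x + v x)%R < +oo)%E.
Proof.
move=> uf vf; rewrite /energy.
rewrite (eq_sqsum _ (g := fun k => c * diff_along u k + diff_along v k)).
  exact: sqsum_lin_lty.
by move=> k; congr (_ ^+ 2); rewrite /diff_along; ring.
Qed.

Lemma energy_lin_le (c : R) u v : (energy S (fun x => c * u x + v x)%R <=
  2%:E * ((c ^+ 2)%:E * energy S u + energy S v))%E.
Proof.
rewrite -sqsumZ; apply: le_trans _ (sqsumD_le _ _ _).
rewrite le_eqVlt; apply/orP; left; apply/eqP; apply: eq_sqsum => k.
by congr (_ ^+ 2); rewrite /diff_along; ring.
Qed.

Lemma D12_norm_lt u (eps : R) : 0 < eps ->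
  (D12_norm S u < eps%:E)%E = (energy S u < (eps ^+ 2)%:E)%E.
Proof.
move=> eps0; rewrite D12_normE; have := energy_ge0 S u.
case: (energy S u) => [e e0| |//]; last first.
  by rewrite poweRyr ?invr_eq0//= !ltNge !leey.
rewrite poweR_EFin !lte_fin powR12_sqrt//.
have {1}-> : eps = Num.sqrt (eps ^+ 2) by rewrite sqrtr_sqr gtr0_norm.
by rewrite ltr_sqrt ?exprn_gt0.
Qed.

Lemma D12_norm_lty u : (D12_norm S u < +oo)%E <-> (energy S u < +oo)%E.
Proof.
rewrite D12_normE; split; last exact: poweR_lty.
by apply: lty_poweRy; rewrite invr_eq0.
Qed.

Definition energy_cauchy w := forall eps : R, 0 < eps ->
  exists n0 : nat, forall m n, (n0 <= m)%N -> (n0 <= n)%N ->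
  (energy S (fun x => w m x - w n x)%R < eps%:E)%E.

(** In terms of the squared norm, which [energy_lin_le] controls under linear
    combinations. *)
Lemma D012P u : D012 S u <-> exists w,
  [/\ forall n, finitely_supported (w n), energy_cauchy w &
      forall x, w n x @[n --> \oo] --> u x].
Proof.
split=> -[w [fw cw wu]]; exists w; split => // eps eps0.
  have [|n0 H] := cw (Num.sqrt eps); first by rewrite sqrtr_gt0.
  exists n0 => m n n0m n0n; have := H m n n0m n0n.
  by rewrite D12_norm_lt ?sqrtr_gt0// sqr_sqrtr// ltW.
have [|n0 H] := cw (eps ^+ 2); first by rewrite exprn_gt0.
exists n0 => m n n0m n0n; rewrite D12_norm_lt//; exact: H.
Qed.

Lemma finitely_supported_lin (c : R) u v : finitely_supported u ->
  finitely_supported v -> finitely_supported (fun x => c * u x + v x).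
Proof.
move=> fu fv; apply: (@sub_finite_set _ _ ([set x | u x != 0] `|` [set x | v x != 0])).
  move=> x /=; have [->|] := eqVneq (u x) 0; last by left.
  by rewrite mulr0 add0r; right.
by rewrite finite_setU.
Qed.

Lemma D012_lin (c : R) u v : D012 S u -> D012 S v ->
  D012 S (fun x => c * u x + v x).
Proof.
move=> /D012P[w [fw cw wu]] /D012P[z [fz cz zv]]; apply/D012P.
exists (fun n x => c * w n x + z n x); split=> [n||x].
- exact: finitely_supported_lin.
(* The bound of [energy_lin_le] is 2 (c^2 del + del) = eps. *)
- move=> eps eps0; pose del := eps / (2 * (c ^+ 2 + 1)).
  have c21 : 0 < c ^+ 2 + 1 by rewrite ltr_wpDl ?sqr_ge0.
  have del0 : 0 < del by rewrite divr_gt0// mulr_gt0.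
  have [m0 Hw] := cw _ del0; have [n0 Hz] := cz _ del0.
  exists (maxn m0 n0) => m n; rewrite !geq_max => /andP[m1 m2] /andP[n1 n2].
  have {}Hw := Hw m n m1 n1; have {}Hz := Hz m n m2 n2.
  rewrite (_ : (fun x => _) = fun x => c * (w m x - w n x) + (z m x - z n x)); last first.
    by apply/funext => x; ring.
  apply: le_lt_trans (energy_lin_le _ _ _) _.
  move: Hw Hz.
  have := energy_ge0 S (fun x => w m x - w n x).
  have := energy_ge0 S (fun x => z m x - z n x).
  case: (energy S _) => [e1| |]//; case: (energy S _) => [e2| |]//.
  rewrite -?EFinM -?EFinD -?EFinM !lee_fin !lte_fin => e10 e20 e2d e1d.
  rewrite (_ : eps = 2 * (c ^+ 2 * del + del)); last first.
    by rewrite /del; field; rewrite gt_eqF.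
  rewrite ltr_pM2l//; apply: ler_ltD => //.
  by rewrite ler_wpM2l ?sqr_ge0// ltW.
- by apply: cvgD; [apply: cvgMr|exact: zv]; exact: wu.
Qed.

Lemma energy_finitely_supported u : finitely_supported u ->
  (energy S u < +oo)%E.
Proof.
move=> fu; pose X := [set x | u x != 0].
(* The arcs that start or end in the support. *)
pose A := [set (p.1, (p.1 * p.2)%g) | p in X `*` [set` S]] `|`
          [set ((p.1 * (p.2)^-1)%g, p.1) | p in X `*` [set` S]].
apply: (@esum_lty_finite_support _ _ _ A) => [k||[x y] [s sS /= ->] nA].
- exact: sqr_ge0.
- by rewrite finite_setU; split; apply: finite_image; apply: finite_setX.
have ux : u x = 0.
  apply: contra_notP nA => /eqP ux; left; exists (x, s) => //.
have uy : u (x * s)%g = 0.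
  apply: contra_notP nA => /eqP uy; right; exists ((x * s)%g, s) => //=.
  by rewrite mulgK.
by rewrite /diff_along/= ux uy subrr expr0n.
Qed.

Lemma D012_0 : D012 S (fun=> 0 : R).
Proof.
apply/D012P; exists (fun _ _ => 0); split=> [n||x]; last exact: cvg_cst.
  by apply: (@sub_finite_set _ _ set0) => // x /=; rewrite eqxx.
move=> eps eps0; exists 0%N => m n _ _.
rewrite /energy /sqsum esum1 ?lte_fin// => k _.
by rewrite /diff_along !subrr expr0n.
Qed.

Lemma cvg_half_le (a : nat -> R) (l : R) : a n @[n --> \oo] --> l ->
  \forall n \near \oo, `|l| / 2 <= `|a n|.
Proof.
have [-> _|l0 al] := eqVneq l 0.
  by apply: nearW => n; rewrite normr0 mul0r.
have : `|a n| @[n --> \oo] --> `|l| by exact: cvg_norm.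
move=> /cvgr_ge; apply; rewrite ltr_pdivrMr// ltr_pMr ?normr_gt0//.
by rewrite ltr1n.
Qed.

End Completion.

(** * Consequences of the Sobolev inequality *)

Section SobolevLimits.
Context {R : realType} {G : groupType} (S : {fset G}) (p K : R).
Hypothesis p_gt0 : 0 < p.
Hypothesis K_gt0 : 0 < K.
Hypothesis sobolev_ineq : forall (f : G -> R) (q : R), finitely_supported f ->
  (energy S f <= q%:E)%E ->
  (\esum_(x in [set: G]) (`|f x| `^ p)%:E <= (K * q `^ (p / 2))%:E)%E.

Lemma pointwise_bound (f : G -> R) (q : R) x : finitely_supported f ->
  (energy S f <= q%:E)%E -> `|f x| `^ p <= K * q `^ (p / 2).
Proof.
move=> ff fq; rewrite -lee_fin; apply: le_trans (sobolev_ineq ff fq).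
apply: le_trans (_ : _ <= (\sum_(y <- [fset x]%fset) `|f y| `^ p)%:E)%E _.
  by rewrite big_seq_fset1.
by apply: fsum_le_esum => // y; exact: powR_ge0.
Qed.

(** By the Sobolev inequality the energy of a difference controls its value at
    each vertex. *)
Lemma energy_cauchy_cvg (w : nat -> G -> R) :
  (forall n, finitely_supported (w n)) -> energy_cauchy S w ->
  exists u : G -> R, forall x, w n x @[n --> \oo] --> u x.
Proof.
move=> fw cw; suff cvgw x : cvgn (fun n => w n x).
  by exists (fun x => limn (fun n => w n x)) => x; exact: cvgw.
apply/cauchy_cvgP/cauchy_exP => eps eps0.
(* With this q, K * q^(p/2) is half of eps^p. *)
pose q := (eps `^ p / (2 * K)) `^ (2 / p).
have e0 : 0 < eps `^ p by exact: powR_gt0.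
have q0 : 0 < q by rewrite powR_gt0// divr_gt0// mulr_gt0.
have [n0 H] := cw q q0.
exists (w n0 x); exists n0 => // n /= n0n.
rewrite /ball/= ltNge; apply/negP => epsw.
have fd : finitely_supported (fun y => w n0 y - w n y).
  have := finitely_supported_lin (-1) (fw n) (fw n0).
  by congr finitely_supported; apply/funext => y; ring.
have := pointwise_bound x fd (ltW (H n0 n (leqnn _) n0n)).
rewrite /q -powRrM (_ : 2 / p * (p / 2) = 1); last by field; rewrite gt_eqF.
rewrite powRr1; last by rewrite divr_ge0// ?ltW// mulr_gt0.
rewrite (_ : K * _ = eps `^ p / 2); last by field; rewrite gt_eqF.
apply/negP; rewrite -ltNge; apply: (@lt_le_trans _ _ (eps `^ p)).
  by rewrite ltr_pdivrMr// ltr_pMr// ltr1n.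
by apply: ge0_ler_powR; rewrite ?nnegrE ?(ltW p_gt0) ?(ltW eps0).
Qed.

(** The approximating sequence has bounded energy, hence bounded l^p norm;
    Fatou's lemma is applied to half of the limit, which the approximants
    eventually dominate. *)
Lemma D012_ell_energy (u : G -> R) : D012 S u ->
  ell p u /\ (energy S u < +oo)%E.
Proof.
move=> /D012P[w [fw cw wu]].
have [n0 H] := cw 1 ltr01.
have /fineK q0E : energy S (w n0) \is a fin_num.
  by rewrite ge0_fin_numE ?energy_ge0// energy_finitely_supported.
pose q : R := 2 * (1 + fine (energy S (w n0))).
have wq n : (energy S (w (n + n0)%N) <= q%:E)%E.
  rewrite (_ : w (n + n0)%N =
      fun x => 1 * (w (n + n0)%N x - w n0 x) + w n0 x); last first.
    by apply/funext => x; ring.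
  apply: le_trans (energy_lin_le _ _ _ _) _.
  rewrite (_ : q%:E = (2%:E * (1%:E + energy S (w n0)))%E); last first.
    by rewrite -q0E.
  apply: lee_wpmul2l; first by rewrite lee_fin.
  rewrite expr1n mul1e; apply: leeD => //.
  by apply/ltW/H => //; exact: leq_addl.
have wun x : w (n + n0)%N x @[n --> \oo] --> u x.
  by move: (wu x); rewrite -(cvg_shiftn n0).
split.
  have : (\esum_(x in [set: G]) (2^-1 `^ p * `|u x| `^ p)%:E <= (K * q `^ (p / 2))%:E)%E.
    apply: (esum_eventually_le (b := fun n x => `|w (n + n0)%N x| `^ p)).
    - by move=> n x; exact: powR_ge0.
    - by move=> n; exact: sobolev_ineq.
    - move=> x; apply: filterS (cvg_half_le (wun x)) => n uw.
      by rewrite -powRM// mulrC; apply: ge0_ler_powR; rewrite ?nnegrE ?(ltW p_gt0) ?divr_ge0.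
  rewrite esumZ ?powR_ge0// => H1.
  rewrite /ell/= ltey; apply/eqP => uoo; move: H1.
  by rewrite uoo gt0_muley ?lte_fin ?powR_gt0.
have : (\esum_(k in arcs S) (4^-1 * diff_along u k ^+ 2)%:E <= q%:E)%E.
  apply: (esum_eventually_le (b := fun n k => diff_along (w (n + n0)%N) k ^+ 2)).
  - by move=> n x; exact: sqr_ge0.
  - by move=> n; exact: wq.
  - move=> k; have dk : diff_along (w (n + n0)%N) k @[n --> \oo] --> diff_along u k.
      by apply: cvgB; exact: wun.
    apply: filterS (cvg_half_le dk) => n uw.
    rewrite (_ : 4^-1 = 2^-1 ^+ 2); last by field.
    rewrite -exprMn mulrC -[leLHS]real_normK ?num_real// -[leRHS]real_normK ?num_real//.
    by apply: lerXn2r; rewrite ?nnegrE// normrM [X in _ * X]ger0_norm.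
rewrite esumZ// => [H1|x]; last exact: sqr_ge0.
rewrite ltey; apply/eqP => uoo; move: H1.
by rewrite -/(sqsum _ _) -/(energy S u) uoo gt0_muley ?lte_fin.
Qed.

Lemma ell_lin (c : R) (u v : G -> R) : ell p u -> ell p v ->
  ell p (fun x => c * u x + v x).
Proof.
rewrite /ell/= => up vp.
apply: (@le_lt_trans _ _ (\esum_(x in [set: G])
    ((2 `^ p * `|c| `^ p) * `|u x| `^ p)%:E +
    \esum_(x in [set: G]) (2 `^ p * `|v x| `^ p)%:E)%E); last first.
  rewrite !esumZ ?mulr_ge0 ?powR_ge0//; do ?by move=> x; exact: powR_ge0.
  by apply: lte_add_pinfty; apply: lte_mul_pinfty => //; rewrite lee_fin ?mulr_ge0 ?powR_ge0.
rewrite -esumD => [|x _|x _]; last 2 first.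
- by rewrite lee_fin !mulr_ge0 ?powR_ge0.
- by rewrite lee_fin !mulr_ge0 ?powR_ge0.
apply: le_esum => x _; rewrite -EFinD lee_fin -mulrA -powRM// -normrM.
set a := c * u x; set b := v x.
pose M := Num.max `|a| `|b|.
have M0 : 0 <= M by rewrite le_max normr_ge0.
apply: (@le_trans _ _ ((2 * M) `^ p)).
  apply: ge0_ler_powR; rewrite ?nnegrE ?(ltW p_gt0) ?mulr_ge0//.
  apply: le_trans (ler_normD _ _) _; rewrite mulr2n mulrDl mul1r.
  by apply: lerD; rewrite le_max lexx ?orbT.
rewrite powRM// -mulrDr ler_wpM2l ?powR_ge0// /M.
by have [_|_] := leP `|a| `|b|; rewrite ?lerDl ?lerDr powR_ge0.
Qed.

End SobolevLimits.

(** * Gradient and divergence *)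

Section Gradient.
Context {R : realType} {G : groupType} (S : {fset G}) (E : set (G * G)).
Hypothesis S_sym : symmetric_fset S.
Hypothesis E_orient : orientation S E.
Implicit Types (u : G -> R) (a b : E -> R).

Lemma adj_sym x y : adj S x y -> adj S y x.
Proof. by case=> s sS ->; exists s^-1%g; rewrite ?S_sym// mulgK. Qed.

Lemma sqsum_grad u : sqsum [set: E] (grad E u) = sqsum E (diff_along u).
Proof.
rewrite /sqsum [RHS](reindex_esum [set: E] E val)//.
split=> [e _|e f _ _ /val_inj//|k Ek]; first exact: set_mem (valP e).
by exists (exist _ k (mem_set Ek)).
Qed.

Lemma sqsum_grad_le u : (sqsum [set: E] (grad E u) <= energy S u)%E.
Proof.
rewrite sqsum_grad; apply: le_esum_set => [k|[x y] Exy]; first exact: sqr_ge0.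
by apply: adj_sym; case: E_orient => + _ _; apply.
Qed.

(** Each arc is an edge or a reversed edge, and reversal only changes the sign
    of the gradient. *)
Lemma energy_le_grad u :
  (energy S u <= 2%:E * sqsum [set: E] (grad E u))%E.
Proof.
pose sw (k : G * G) := (k.2, k.1).
have -> : (2%:E * sqsum [set: E] (grad E u) =
    \esum_(k in E) (diff_along u k ^+ 2)%:E +
    \esum_(k in sw @` E) (diff_along u k ^+ 2)%:E)%E.
  rewrite sqsum_grad (@esum_image _ _ _ E sw (fun k => (diff_along u k ^+ 2)%:E)).
    rewrite (_ : 2%:E = 1%:E + 1%:E :> \bar R)%E; last by rewrite -EFinD.
    rewrite ge0_muleDl ?lee_fin// mul1e; congr (_ + _)%E.
    by apply: eq_sqsum => k; rewrite /diff_along -sqrrN opprB.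
  by move=> [x y] [x' y'] _ _ [-> ->].
apply: esum_setU_le => [k|[x y] xy]; first exact: sqr_ge0.
have [_ /(_ _ _ xy) Eo _] := E_orient.
by case: Eo => [Eyx|Exy]; [right; exists (y, x)|left].
Qed.

Definition delta (x : G) : G -> R := fun y => (y == x)%:R.

Lemma finitely_supported_delta x : finitely_supported (delta x).
Proof.
apply: (@sub_finite_set _ _ [set x]) => // y /=; rewrite /delta.
by have [//|] := eqVneq y x; rewrite eqxx.
Qed.

Definition incident (x : G) : set E :=
  [set e : E | (val e).2 = x] `|` [set e : E | (val e).1 = x].

Lemma incident_finite x : finite_set (incident x).
Proof.
have [Eadj _ _] := E_orient.
have Eval (e : E) : E (val e) by exact: set_mem (valP e).
rewrite finite_setU; split.
  apply: (@sub_finite_set _ _ (val @^-1` [set ((x * s)%g, x) | s in [set` S]])).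
    have key k : E k -> k.2 = x -> [set ((x * s)%g, x) | s in [set` S]] k.
      by case: k => y z /Eadj[s sS /= -> ->]; exists s.
    by move=> e; exact: key.
  apply: finite_preimage; first by move=> e f _ _; exact: val_inj.
  exact: finite_image.
apply: (@sub_finite_set _ _ (val @^-1` [set (x, (x * s^-1)%g) | s in [set` S]])).
  have key k : E k -> k.1 = x -> [set (x, (x * s^-1)%g) | s in [set` S]] k.
    by case: k => y z /Eadj[s sS /= -> <-]; exists s => //; rewrite mulgK.
  by move=> e; exact: key.
apply: finite_preimage; first by move=> e f _ _; exact: val_inj.
exact: finite_image.
Qed.

(** Summation by parts against the indicator of [x]; loops cancel on both
    sides. *)
Lemma div_pairing a x :
  div a x = \sum_(e <- fset_set (incident x)) a e * grad E (delta x) e.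
Proof.
have fsum (c : E -> G) : [set e | c e = x] `<=` incident x ->
    \sum_(e \in [set e | c e = x]) a e =
    \sum_(e <- fset_set (incident x)) a e * (c e == x)%:R.
  move=> cx; rewrite -(fsbig_finite _ _ (incident_finite x)).
  rewrite -(@fsbig_widen _ _ _ _ [set e | c e = x])//.
    by apply: eq_fsbigr => e; rewrite inE/= => ->; rewrite eqxx mulr1.
  by move=> e [_ /= /eqP/negPf ->]; rewrite mulr0.
rewrite /div !fsum => [|e|e]; [|by right|by left].
by rewrite -sumrB; apply: eq_bigr => e _; rewrite -mulrBr.
Qed.

Lemma grad_delta0 x (e : E) :
  e \notin fset_set (incident x) -> grad E (delta x) e = 0.
Proof.
rewrite in_fset_set; last exact: incident_finite.
move=> /negP ex; rewrite /grad /delta.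
have /negPf -> : (val e).2 != x by apply/eqP => ?; apply: ex; rewrite inE; left.
have /negPf -> : (val e).1 != x by apply/eqP => ?; apply: ex; rewrite inE; right.
by rewrite subrr.
Qed.

Lemma div_lin (c : R) a b x :
  div (fun e => c * a e + b e) x = c * div a x + div b x.
Proof.
rewrite !div_pairing mulr_sumr -big_split/=; apply: eq_bigr => e _.
by rewrite mulrDl mulrA.
Qed.

Lemma grad_lin (c : R) u v :
  grad E (fun x => c * u x + v x) = (fun e => c * grad E u e + grad E v e).
Proof. by apply/funext => e; rewrite /grad; ring. Qed.

(** At a maximum [y] of [u], every term of the sum in [div_pairing] is
    nonnegative. *)
Lemma harmonic_max u y : div (grad E u) y = 0 -> (forall x, u x <= u y) ->
  forall x, adj S x y -> u x = u y.
Proof.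
move=> + umax x xy; rewrite div_pairing => /eqP.
have term0 e : 0 <= grad E u e * grad E (delta y) e.
  rewrite /grad /delta; have [e2|_] := eqVneq (val e).2 y.
    rewrite e2; have [->|_] := eqVneq (val e).1 y; first by rewrite !subrr mulr0.
    by rewrite subr0 mulr1 subr_ge0.
  have [->|_] := eqVneq (val e).1 y; last by rewrite subr0 mulr0.
  by rewrite sub0r mulrN1 oppr_ge0 subr_le0.
rewrite psumr_eq0// => /allP uy0.
have [xy0|xNy] := eqVneq x y; first by rewrite xy0.
have [_ /(_ _ _ xy) Eo _] := E_orient.
have edge0 k (Ek : E k) : (k.2 == y) || (k.1 == y) ->
    (u k.2 - u k.1) * (delta y k.2 - delta y k.1) = 0.
  move=> ky; have := uy0 (exist _ k (mem_set Ek)).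
  rewrite in_fset_set; last exact: incident_finite.
  move=> H; apply/eqP/H; rewrite inE.
  by case/orP: ky => /eqP; [left|right].
case: Eo => [Exy|Eyx].
  have := edge0 _ Exy; rewrite /delta/= eqxx (negPf xNy) => /(_ isT).
  by rewrite subr0 mulr1 => /eqP; rewrite subr_eq0 => /eqP.
have := edge0 _ Eyx; rewrite /delta/= eqxx (negPf xNy) orbT => /(_ isT).
by rewrite sub0r mulrN1 => /eqP; rewrite oppr_eq0 subr_eq0 => /eqP.
Qed.

End Gradient.

(** * Harmonic functions in l^p *)

Section MaximumPrinciple.
Context {R : realType} {G : groupType} (S : {fset G}) (E : set (G * G)).
Hypothesis S_gen : generating S.
Hypothesis E_orient : orientation S E.
Hypothesis G_infinite : infinite_set [set: G].

Lemma esum_lty_finite_level (T : choiceType) (a : T -> R) (c : R) :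
  (forall x, 0 <= a x) -> 0 < c ->
  (\esum_(x in [set: T]) (a x)%:E < +oo)%E -> finite_set [set x | c <= a x].
Proof.
move=> a0 c0 afin; apply: contrapT => /infinite_set_fset infA.
have : (0 <= \esum_(x in [set: T]) (a x)%:E)%E.
  by apply: esum_ge0 => x _; rewrite lee_fin.
have := @fsum_le_esum R T [set: T] _ a a0.
move: afin; case: (\esum_(_ in _) _) => [M| |]// _ aM; rewrite lee_fin => M0.
have [B BA nB] := infA (Num.truncn (M / c)).+1.
have := aM B (fun _ _ => I); rewrite lee_fin; apply/negP; rewrite -ltNge.
apply: (@lt_le_trans _ _ (\sum_(x <- B) c)).
  rewrite big_const_seq iter_addr_0 count_predT -(mulr_natr c) mulrC -ltr_pdivrMr//.
  by apply: lt_le_trans (truncnS_gt _) _; rewrite ler_nat.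
by rewrite big_seq [leRHS]big_seq; apply: ler_sum => x /BA.
Qed.

Lemma seq_argmax (T : eqType) (s : seq T) (f : T -> R) x0 : x0 \in s ->
  exists2 y, y \in s & forall x, x \in s -> f x <= f y.
Proof.
elim: s x0 => // z s IHs x0 _; case: s IHs => [_|z' s IHs].
  by exists z; rewrite ?mem_head// => x; rewrite inE => /eqP ->.
have [y ys fy] := IHs z' (mem_head _ _).
have [zy|/ltW yz] := leP (f z) (f y).
  exists y => [|x]; first by rewrite in_cons ys orbT.
  by rewrite in_cons => /predU1P[->|/fy].
exists z; rewrite ?mem_head// => x; rewrite in_cons => /predU1P[->//|/fy xy].
exact: le_trans xy yz.
Qed.

(** A positive value makes a superlevel set nonempty, and summability of |u|^p
    makes it finite, so [u] has a positive maximum. By [harmonic_max] it is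
    attained everywhere, so that all of [G] would be such a superlevel set. *)
Lemma harmonic_le0 (p : R) (u : G -> R) : 0 < p -> ell p u ->
  (forall x, div (grad E u) x = 0) -> forall x, u x <= 0.
Proof.
move=> p0 up hu x0; rewrite leNgt; apply/negP => ux0.
have level (c : R) : 0 < c -> finite_set [set x | c <= u x].
  move=> c0; apply: (@sub_finite_set _ _ [set x | c `^ p <= `|u x| `^ p]).
    move=> x /= cx; apply: ge0_ler_powR; rewrite ?nnegrE ?(ltW p0) ?(ltW c0)//.
    exact: le_trans cx (ler_norm _).
  by apply: esum_lty_finite_level; rewrite ?powR_gt0// => x; exact: powR_ge0.
have fin0 := level _ ux0.
have x0in : x0 \in fset_set [set x | u x0 <= u x].
  by rewrite in_fset_set// inE/=.
have [y yin ymax] := seq_argmax u x0in.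
have uy : u x0 <= u y by exact: ymax.
have umax x : u x <= u y.
  have [xx0|/ltW xx0] := leP (u x0) (u x); last exact: le_trans uy.
  by apply: ymax; rewrite in_fset_set// inE.
(* The maximum spreads along paths from y. *)
have uconst w : {subset w <= S} -> u (y * \prod_(s <- w) s)%g = u y.
  elim/last_ind: w => [|w s IHw] wS; first by rewrite big_nil mulg1.
  have wS' : {subset w <= S}.
    by move=> t tw; apply: wS; rewrite mem_rcons inE tw orbT.
  have sS : s \in S by apply: wS; rewrite mem_rcons mem_head.
  have uz := IHw wS'.
  rewrite -cats1 big_cat big_seq1/= mulgA -uz.
  apply: (harmonic_max E_orient (hu _)) => [x|]; first by rewrite uz.
  by exists s.
apply: G_infinite; apply: sub_finite_set (level _ (lt_le_trans ux0 uy)) => z _ /=.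
have [w [wS wE]] := S_gen (y^-1 * z)%g.
by have := uconst w wS; rewrite wE mulVKg => ->.
Qed.

Lemma harmonic_eq0 (p : R) (u : G -> R) : 0 < p -> ell p u ->
  (forall x, div (grad E u) x = 0) -> u = fun=> 0.
Proof.
move=> p0 up hu; apply/funext => x; apply/eqP; rewrite eq_le.
rewrite (harmonic_le0 p0 up hu)/= -oppr_le0.
apply: (harmonic_le0 (u := fun x => - u x) p0) => [|y].
  by rewrite /ell/=; under eq_esum do rewrite normrN.
rewrite (_ : grad E _ = fun e => -1 * grad E u e + grad E (fun=> 0) e).
  rewrite (div_lin E_orient) hu mulr0 add0r (div_pairing E_orient) big1// => e _.
  by rewrite /grad subrr mul0r.
by apply/funext => e; rewrite /grad; ring.
Qed.

End MaximumPrinciple.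

(** Otherwise the balls have at most |G| elements, against C n^N >= C n. *)
Lemma growth_infinite (R : realType) (G : groupType) (S : {fset G}) (N C : R) :
  1 <= N -> 0 < C ->
  (forall n : nat, (1 <= n)%N -> C * n%:R `^ N <= (growth S n)%:R) ->
  infinite_set [set: G].
Proof.
move=> N1 C0 gr finG; set c := #|` fset_set [set: G]|.
have gc n : (growth S n <= c)%N.
  apply: fsubset_leq_card; apply/fsubsetP => x _.
  by rewrite in_fset_set// inE.
pose n := (Num.truncn (c%:R / C)).+1.
have n1 : 1 <= n%:R :> R by rewrite ler1n.
have := gr n isT; apply/negP; rewrite -ltNge.
apply: (@le_lt_trans _ _ c%:R); first by rewrite ler_nat.
apply: (@lt_le_trans _ _ (C * n%:R)).
  by rewrite mulrC -ltr_pdivrMr//; exact: truncnS_gt.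
by rewrite ler_pM2l// le1r_powR.
Qed.

(** * The decompositions *)

Section Decomposition.
Context {R : realType} {G : groupType} (S : {fset G}) (E : set (G * G)).
Hypothesis S_sym : symmetric_fset S.
Hypothesis S_gen : generating S.
Hypothesis E_orient : orientation S E.

Lemma ell2_grad (u : G -> R) : (energy S u < +oo)%E -> ell 2 (grad E u).
Proof.
by move=> uf; apply/ell2E; apply: le_lt_trans (sqsum_grad_le S_sym E_orient u) uf.
Qed.

Lemma ell2_lin (c : R) (a b : E -> R) : ell 2 a -> ell 2 b ->
  ell 2 (fun e => c * a e + b e).
Proof. by move=> /ell2E af /ell2E bf; apply/ell2E; exact: sqsum_lin_lty. Qed.

(** Common to both decompositions: only the existence of a decomposition
    depends on the space [D]. *)
Lemma direct_sum_grad (p : R) (D : set (G -> R)) :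
  infinite_set [set: G] -> 0 < p -> D (fun=> 0) ->
  (forall (c : R) u v, D u -> D v -> D (fun x => c * u x + v x)) ->
  (forall u, D u -> ell p u /\ (energy S u < +oo)%E) ->
  (forall a : E -> R, ell 2 a -> exists2 u, D u &
     forall x, div (fun e => a e - grad E u e) x = 0) ->
  direct_sum (ell 2 : set (E -> R)) (grad E @` D) (divergence_free E).
Proof.
move=> G_inf p0 D0 Dlin Dp Ddec; split.
- split=> [|c a b].
    rewrite inE; exists (fun=> 0) => //.
    by apply/funext => e; rewrite /grad subrr.
  rewrite !inE => -[u Du <-] [v Dv <-]; exists (fun x => c * u x + v x).
    exact: Dlin.
  exact: grad_lin.
- split=> [|c a b].
    rewrite inE; split; last first.
      by move=> x; rewrite (div_pairing E_orient) big1// => e _; rewrite mul0r.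
    by apply/ell2E; rewrite /sqsum esum1// => x _; rewrite expr0n.
  rewrite !inE => -[a2 ad] [b2 bd]; split; first exact: ell2_lin.
  by move=> x; have := div_lin E_orient c a b x; rewrite ad bd mulr0 addr0.
- apply/seteqP; split=> [a a2|_ [_ [u Du <-] [b [b2 _] <-]]].
    have [u Du au] := Ddec a a2.
    exists (grad E u); first by exists u.
    exists (fun e => a e - grad E u e); last by apply/funext => e; rewrite addrC subrK.
    split=> //; have := ell2_lin (-1) (ell2_grad (Dp _ Du).2) a2.
    by congr (ell 2 _); apply/funext => e; ring.
  have := ell2_lin 1 (ell2_grad (Dp _ Du).2) b2.
  by congr (ell 2 _); apply/funext => e; rewrite mul1r.
- apply/seteqP; split=> [_ [[u Du <-] [_ hu]]|_ ->].
    rewrite (harmonic_eq0 S_gen E_orient G_inf p0 (Dp _ Du).1 hu).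
    by apply/funext => e; rewrite /grad subrr.
  split; first by exists (fun=> 0) => //; apply/funext => e; rewrite /grad subrr.
  split; first by apply/ell2E; rewrite /sqsum esum1// => x _; rewrite expr0n.
  by move=> x; rewrite (div_pairing E_orient) big1// => e _; rewrite mul0r.
Qed.

(** The minimizing sequence over gradients of finitely supported functions
    converges at every vertex by [energy_cauchy_cvg], and the pairings with
    gradients of indicators are finite sums, so their limits are computed
    pointwise. *)
Lemma D012_decomposition (p K : R) : 0 < p -> 0 < K ->
  (forall (f : G -> R) (q : R), finitely_supported f ->
    (energy S f <= q%:E)%E ->
    (\esum_(x in [set: G]) (`|f x| `^ p)%:E <= (K * q `^ (p / 2))%:E)%E) ->
  forall a : E -> R, ell 2 a -> exists2 u : G -> R, D012 S u &
    forall x, div (fun e => a e - grad E u e) x = 0.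
Proof.
move=> p0 K0 sob a /ell2E a2.
have [||w [wW wC wO]] := @minimizing_sequence R E a
  [set grad E v | v in @finitely_supported R G] a2.
- exists (fun=> 0); last by apply/funext => e; rewrite /grad subrr.
  by apply: (@sub_finite_set _ _ set0) => // x /=; rewrite eqxx.
- move=> c _ _ [u fu <-] [v fv <-]; exists (fun x => c * u x + v x).
    exact: finitely_supported_lin.
  exact: grad_lin.
have /choice[v vP] n : exists v, finitely_supported v /\ grad E v = w n.
  by have [v fv vw] := wW n; exists v.
have fv n : finitely_supported (v n) := (vP n).1.
have vC : energy_cauchy S v.
  move=> eps eps0.
  (* The energy is at most twice the square sum over the edges, itself at most
     2 (1/(m+1) + 1/(n+1)) < 4 eps/8. *)
  pose n0 := Num.truncn (8 / eps).
  have n0e : n0.+1%:R^-1 < eps / 8.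
    by rewrite -(invf_div 8 eps) ltf_pV2 ?posrE ?divr_gt0// ?ltr0n// truncnS_gt.
  exists n0 => m n n0m n0n.
  apply: le_lt_trans (energy_le_grad E_orient _) _.
  rewrite (_ : sqsum _ _ = sqsum [set: E] (fun e => w m e - w n e)); last first.
    apply: eq_sqsum => e; congr (_ ^+ 2).
    by rewrite -(vP m).2 -(vP n).2 /grad; ring.
  apply: (@le_lt_trans _ _ (2%:E * (2 * (m.+1%:R^-1 + n.+1%:R^-1))%:E)%E).
    by apply: lee_wpmul2l => //; rewrite lee_fin.
  have inv_le k : (n0 <= k)%N -> k.+1%:R^-1 <= n0.+1%:R^-1 :> R.
    by move=> n0k; rewrite lef_pV2 ?posrE ?ltr0n// ler_nat.
  rewrite -EFinM lte_fin; move: (inv_le m n0m) (inv_le n n0n) n0e.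
  set em := m.+1%:R^-1; set en := n.+1%:R^-1; set e0 := n0.+1%:R^-1; lra.
have [u vu] := energy_cauchy_cvg p0 K0 sob fv vC.
exists u; first by apply/D012P; exists v.
move=> x; rewrite (div_pairing E_orient).
set F := fset_set _; set g := grad E (delta x).
pose c n := \sum_(e <- F) (a e - w n e) * g e.
have cu : c n @[n --> \oo] --> \sum_(e <- F) (a e - grad E u e) * g e.
  apply: cvg_big => [|e _]; first exact: add_continuous.
  apply: cvgMl; apply: cvgB; first exact: cvg_cst.
  under eq_fun do rewrite -(vP _).2.
  by apply: cvgB; exact: vu.
have c2 n : c n ^+ 2 <= (1 + \sum_(e <- F) g e ^+ 2) * n.+1%:R^-1.
  apply: wO => [|e]; last exact: (grad_delta0 E_orient).
  by exists (delta x) => //; exact: finitely_supported_delta.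
have c2u : c n ^+ 2 @[n --> \oo] --> (\sum_(e <- F) (a e - grad E u e) * g e) ^+ 2.
  by rewrite expr2; under eq_fun do rewrite expr2; exact: (cvgM cu cu).
have c20 : c n ^+ 2 @[n --> \oo] --> (0 : R).
  apply: (@squeeze_cvgr _ _ _ _ (fun=> 0) (fun n => (1 + \sum_(e <- F) g e ^+ 2) * n.+1%:R^-1)).
  - by apply: nearW => n; rewrite sqr_ge0 c2.
  - exact: cvg_cst.
  - rewrite -[X in _ --> X](mulr0 (1 + \sum_(e <- F) g e ^+ 2)).
    by apply: cvgMr; exact: cvg_harmonic.
apply/eqP; rewrite -sqrf_eq0; apply/eqP.
exact: (cvg_unique _ c2u c20).
Qed.

End Decomposition.

Theorem theorem18 (R : realType) (G : groupType) (S : {fset G})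
    (E : set (G * G)) (N : R)
    (S_sym : symmetric_fset S) (S_gen : generating S)
    (E_orient : orientation S E)
    (N_ge3 : 3 <= N)
    (growth_lb : exists2 C : R, 0 < C &
      forall n : nat, (1 <= n)%N -> C * n%:R `^ N <= (growth S n)%:R) :
  direct_sum (ell 2 : set (E -> R)) (grad E @` D012 S) (divergence_free E) /\
  direct_sum (ell 2 : set (E -> R)) (grad E @` D12 S N) (divergence_free E).
Proof.
have N2 : 2 < N by lra.
have N1 : 1 <= N by lra.
have p0 : 0 < 2 * N / (N - 2) by rewrite divr_gt0 ?subr_gt0// mulr_gt0//; lra.
have [K K0 sob] := sobolev N2 growth_lb.
have G_inf : infinite_set [set: G].
  by have [C C0 gr] := growth_lb; exact: growth_infinite N1 C0 gr.
have D0D u : D012 S u -> D12 S N u.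
  by move=> /(D012_ell_energy p0 sob)[up uf]; split=> //; apply/D12_norm_lty.
have dec := D012_decomposition E_orient p0 K0 sob.
split; apply: (direct_sum_grad S_sym S_gen E_orient G_inf p0).
- exact: D012_0.
- exact: D012_lin.
- by move=> u; exact: (D012_ell_energy p0 sob).
- exact: dec.
- exact/D0D/D012_0.
- move=> c u v [up /D12_norm_lty uf] [vp /D12_norm_lty vf]; split.
    exact: ell_lin.
  by apply/D12_norm_lty; exact: energy_lin_lty.
- by move=> u [up /D12_norm_lty uf].
- by move=> a /dec[u Du au]; exists u => //; exact: D0D.
Qed.
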